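(* Let $p>2$ (possibly $p=\infty$), $n\ge2$, $0<\epsilon<1$, $0<\delta<1/2$. Consider the collision tester: draw $m$ i.i.d. samples from the unknown distribution $A$ on $\{1,\dots,n\}$, let $C$ be the number of pairs $1\le j<k\le m$ whose $j$th and $k$th samples are equal, let $T=\binom m2\frac1n+\sqrt{\frac1\delta\binom m2\frac1n}$, and output ``uniform'' iff $C\le T$. With \[ m=\frac9\delta\begin{cases}\dfrac{1}{\sqrt n\,\epsilon^2} & n\le\frac1{\epsilon^2},\\[1em] \dfrac1\epsilon & n\ge\frac1{\epsilon^2},\end{cases}\] this tester solves uniformity testing in $\ell_p$ distance: if $A=U_n$ it outputs ``uniform'' with probability at least $1-\delta$, and if $\|A-U_n\|_p\ge\epsilon$ it outputs ``not uniform'' with probability at least $1-\delta$.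
   Context: A distribution on support size $n$ is a vector $A\in\mathbb{R}^n$ with $A_i\ge0$, $\sum_iA_i=1$; $U_n$ is uniform; $\|V\|_p=(\sum_i|V_i|^p)^{1/p}$, $\|V\|_\infty=\max_i|V_i|$. *)

(* Defs.v *)
From mathcomp Require Import all_boot all_order all_algebra.
From mathcomp Require Import reals constructive_ereal exp.

Set Implicit Arguments.
Unset Strict Implicit.
Unset Printing Implicit Defensive.

Import Order.TTheory GRing.Theory Num.Theory.
Local Open Scope ring_scope.

Section Definitions.
Variable R : realType.

(* The support {1, ..., n} is indexed by 'I_n. *)
Definition is_distribution n (A : 'rV[R]_n) : Prop :=
  (forall i, 0 <= A 0 i) /\ \sum_i A 0 i = 1.

Definition unif n : 'rV[R]_n := const_mx (n%:R^-1).

(* The value at p = -oo is junk. *)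
Definition lp_norm (p : \bar R) n (V : 'rV[R]_n) : R :=
  match p with
  | r%:E%E => (\sum_i `|V 0 i| `^ r) `^ r^-1
  | +oo%E => \big[Num.max/0]_i `|V 0 i|
  | -oo%E => 0
  end.

(* Probability of the event E when the sample x consists of m independent
   draws from A, i.e. under the m-fold product distribution. *)
Definition Pr_iid n (A : 'rV[R]_n) m (E : pred (m.-tuple 'I_n)) : R :=
  \sum_(x : m.-tuple 'I_n | E x) \prod_(j < m) A 0 (tnth x j).

Definition collisions n m (x : m.-tuple 'I_n) : nat :=
  #|[set jk : 'I_m * 'I_m | (jk.1 < jk.2)%N & tnth x jk.1 == tnth x jk.2]|.

Definition collision_threshold (delta : R) (n m : nat) : R :=
  'C(m, 2)%:R * (1 / n%:R)
  + Num.sqrt (1 / delta * 'C(m, 2)%:R * (1 / n%:R)).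

(* The output [true] means "uniform". *)
Definition collision_tester (delta : R) n m (x : m.-tuple 'I_n) : bool :=
  (collisions x)%:R <= collision_threshold delta n m.

(* The two cases agree when n = 1 / eps^2. *)
Definition sample_bound (n : nat) (eps delta : R) : R :=
  9 / delta * (if n%:R <= 1 / eps ^+ 2 then 1 / (Num.sqrt n%:R * eps ^+ 2)
               else 1 / eps).

(* A number of samples is an integer, so the real bound is rounded up. *)
Definition num_samples (n : nat) (eps delta : R) : nat :=
  `|Num.ceil (sample_bound n eps delta)|%N.

End Definitions.

Arguments unif R n : clear implicits.

(* Main.v *)
(** Since p > 2, ||A - U_n||_p <= ||A - U_n||_2, so only x = ||A - U_n||_2
    matters. With N pairs of samples, the collision count has mean
    N ||A||_2^2 = N (1/n + x^2) and variance
    N (s2 - s2^2) + m (m - 1) (m - 2) (s3 - s2^2), where s_k = sum_i A_i^k, and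
    s3 - s2^2 <= x^2/n + x^3 - x^4. Chebyshev's inequality concludes in both
    cases. When A is far from uniform, the two-case formula for m is the maximum
    of its branches, so that delta m x >= 9 and delta m sqrt(n) x^2 >= 9 both
    hold; then the threshold is at most 1/8 of the way from N/n to the mean, and
    the variance is small compared with the square of the remaining gap. *)
Require Import Defs.
From mathcomp Require Import all_boot all_order all_algebra.
From mathcomp Require Import reals constructive_ereal exp.
From mathcomp Require Import ring lra.

Set Implicit Arguments.
Unset Strict Implicit.
Unset Printing Implicit Defensive.

Import Order.TTheory GRing.Theory Num.Theory.
Local Open Scope ring_scope.

(** * Expectation over independent samples, and Chebyshev's inequality *)

Section IidExpectation.
Variables (R : realFieldType) (T : finType) (w : T -> R).

(** Expectation over [m] independent draws of weight [w], taken one draw at a time over plain lists,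
    so that moments follow by induction on [m]. *)
Fixpoint iidE (m : nat) (f : seq T -> R) : R :=
  if m is m'.+1 then \sum_y w y * iidE m' (fun s => f (y :: s)) else f [::].

Lemma eq_iidE m f g : (forall s, size s = m -> f s = g s) -> iidE m f = iidE m g.
Proof.
elim: m f g => [|m IHm] f g fg /=; first exact: fg.
by apply: eq_bigr => y _; congr (_ * _); apply: IHm => s sm; apply: fg; rewrite /= sm.
Qed.

Lemma iidED m f g : iidE m (fun s => f s + g s) = iidE m f + iidE m g.
Proof.
elim: m f g => [//|m IHm] f g /=.
by rewrite -big_split; apply: eq_bigr => y _; rewrite IHm mulrDr.
Qed.

Lemma iidEZ m c f : iidE m (fun s => c * f s) = c * iidE m f.
Proof.
elim: m f => [//|m IHm] f /=.
by rewrite big_distrr; apply: eq_bigr => y _; rewrite IHm mulrCA.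
Qed.

Lemma iidE_sum (I : finType) m (f : I -> seq T -> R) :
  iidE m (fun s => \sum_i f i s) = \sum_i iidE m (f i).
Proof.
elim: m f => [//|m IHm] f /=.
rewrite exchange_big; apply: eq_bigr => y _.
by rewrite IHm big_distrr.
Qed.

(** Link with the product-measure sum of [Pr_iid]: splitting a tuple into head and tail is a
    bijection compatible with the recursion. *)
Lemma iidE_tuple m (f : seq T -> R) :
  iidE m f = \sum_(x : m.-tuple T) f x * \prod_(j < m) w (tnth x j).
Proof.
elim: m f => [|m IHm] f /=.
  by rewrite (big_pred1 [tuple]) => [|x]; rewrite ?big_ord0 ?mulr1 //=; apply/esym/eqP/tuple0.
under eq_bigr do rewrite IHm big_distrr /=.
rewrite pair_big /=.
rewrite (reindex (fun u : T * m.-tuple T => [tuple of u.1 :: u.2])) /=; last first.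
  exists (fun x : m.+1.-tuple T => (thead x, [tuple of behead x])) => [[y x]|x] _.
    by congr (_, _); apply: val_inj.
  by rewrite [RHS](tuple_eta x).
apply: eq_bigr => -[y x] _ /=.
rewrite big_ord_recl /= (_ : tnth _ ord0 = y) //.
rewrite mulrCA; congr (_ * (_ * _)); apply: eq_bigr => j _.
by rewrite tnthS.
Qed.

Hypothesis w_ge0 : forall y, 0 <= w y.
Hypothesis w_sum : \sum_y w y = 1.

Lemma le_iidE m f g : (forall s, size s = m -> f s <= g s) -> iidE m f <= iidE m g.
Proof using w_ge0.
elim: m f g => [|m IHm] f g fg /=; first exact: fg.
apply: ler_sum => y _; apply: ler_wpM2l => //.
by apply: IHm => s sm; apply: fg; rewrite /= sm.
Qed.

Lemma iidE_const m c : iidE m (fun=> c) = c.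
Proof using w_sum.
by elim: m => [//|m IHm] /=; rewrite -big_distrl /= w_sum IHm mul1r.
Qed.

Lemma iidE_centred m (h : T -> R) : \sum_y w y * h y = 0 ->
  iidE m (fun s => \sum_(a <- s) h a) = 0.
Proof using w_sum.
move=> h0; elim: m => [|m IHm] /=; first by rewrite big_nil.
rewrite -[RHS]h0; apply: eq_bigr => y _; congr (_ * _).
rewrite (@eq_iidE _ _ (fun s => h y + \sum_(a <- s) h a)) => [|s _]; last by rewrite big_cons.
by rewrite iidED IHm iidE_const addr0.
Qed.

(** The cross terms between distinct samples vanish by independence, so only the diagonal squares
    remain. *)
Lemma iidE_centred_sqr m (h : T -> R) : \sum_y w y * h y = 0 ->
  iidE m (fun s => (\sum_(a <- s) h a) ^+ 2) = m%:R * \sum_y w y * h y ^+ 2.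
Proof using w_sum.
move=> h0; elim: m => [|m IHm] /=; first by rewrite big_nil expr0n mul0r.
rewrite -natr1 mulrDl mul1r -IHm -[X in X + _]mul1r -w_sum big_distrl -big_split /=.
apply: eq_bigr => y _; rewrite -mulrDr; congr (_ * _).
rewrite (@eq_iidE _ _ (fun s => h y ^+ 2 + (2 * h y * \sum_(a <- s) h a
    + (\sum_(a <- s) h a) ^+ 2))) => [|s _]; last by rewrite big_cons; ring.
by rewrite !iidED iidEZ iidE_centred // iidE_const; ring.
Qed.

Lemma chebyshev_iidE m (P : pred (seq T)) (D : seq T -> R) (t delta : R) :
  0 < t -> iidE m (fun s => D s ^+ 2) <= delta * t ^+ 2 ->
  (forall s, size s = m -> ~~ P s -> t ^+ 2 <= D s ^+ 2) ->
  1 - delta <= iidE m (fun s => (P s)%:R).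
Proof using w_ge0 w_sum.
move=> t0 var DP; have t20 : 0 < t ^+ 2 by rewrite exprn_gt0.
rewrite lerBlDl -lerBlDr -(ler_pM2r t20) (le_trans _ var) //.
(* The left side becomes the expectation of [t ^+ 2] times the indicator of the failure of [P],
   which [D s ^+ 2] dominates pointwise. *)
rewrite mulrC -[X in X - _](iidE_const m) -mulN1r -iidEZ -iidED -iidEZ.
apply: le_iidE => s sm; case: (boolP (P s)) => Ps.
  by rewrite mulN1r subrr mulr0 sqr_ge0.
by rewrite mulr0 addr0 mulr1 DP.
Qed.

End IidExpectation.

(** * The collision count: recursive form, mean and variance *)

Fixpoint seq_collisions (T : eqType) (s : seq T) : nat :=
  if s is y :: s' then (count_mem y s' + seq_collisions s')%N else 0.

(** Each colliding pair is charged to its earlier position; peeling off the first sample then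
    matches the recursion of [iidE]. *)
Lemma collisionsE n m (x : m.-tuple 'I_n) : collisions x = seq_collisions x.
Proof.
have -> : collisions x =
    (\sum_(j < m) \sum_(k < m | j < k) (tnth x j == tnth x k))%N.
  rewrite /collisions cardsE -sum1_card big_mkcond.
  rewrite [RHS](eq_bigr (fun j : 'I_m => \sum_(k < m) ((j < k) && (tnth x j == tnth x k))%N))%N.
    by rewrite pair_bigA; apply: eq_bigr => -[j k] _ /=; rewrite unfold_in /=; case: ifP.
  by move=> j _; rewrite [LHS]big_mkcond; apply: eq_bigr => k _; case: (_ < _)%N.
elim: m x => [|m IHm] x; first by rewrite tuple0 big_ord0.
case/tupleP: x => y x /=; rewrite big_ord_recl -IHm; congr (_ + _)%N.
  rewrite big_mkcond big_ord_recl /= add0n -sum1_count big_tuple [RHS]big_mkcond.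
  by apply: eq_bigr => k _ /=; rewrite tnth0 tnthS eq_sym; case: eqP.
apply: eq_bigr => j _; rewrite big_mkcond big_ord_recl /= add0n [RHS]big_mkcond.
by apply: eq_bigr => k _ /=; rewrite !tnthS.
Qed.

(* Adding a sample [y] in front adds to the centred collision count a sum of
   centred terms over the old samples, plus a term depending on [y] only; the
   variance and the covariance with [S] therefore follow by induction on [m]. *)
Section CollisionVariance.
Variables (R : realFieldType) (T : finType) (w : T -> R).
Hypothesis w_sum : \sum_y w y = 1.

Local Notation E := (iidE w).
Let s2 := \sum_y w y ^+ 2.
Let s3 := \sum_y w y ^+ 3.
Let D (s : seq T) : R := (seq_collisions s)%:R - 'C(size s, 2)%:R * s2.
(** Average of [cnt y s] over a fresh draw [y]; this is how the covariance of [D] and [S] enters the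
    variance recursion. *)
Let S (s : seq T) : R := \sum_(a <- s) (w a - s2).
Let cnt (y : T) (s : seq T) : R := \sum_(a <- s) ((a == y)%:R - w y).

Local Lemma D_cons y s : D (y :: s) = D s + cnt y s + (size s)%:R * (w y - s2).
Proof.
rewrite /D /cnt /= binS bin1 !natrD sumrB big_const_seq count_predT iter_addr_0.
rewrite (_ : \sum_(a <- s) (a == y)%:R = (count_mem y s)%:R); last first.
  by rewrite -sum1_count natr_sum [RHS]big_mkcond; apply: eq_bigr => a _ /=; case: eqP.
by rewrite -[w y *+ _]mulr_natl; ring.
Qed.

Local Lemma S_cons y s : S (y :: s) = S s + (w y - s2).
Proof. by rewrite /S big_cons addrC. Qed.

Local Lemma S_centred : \sum_y w y * (w y - s2) = 0.
Proof.
under eq_bigr do rewrite mulrBr -expr2.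
by rewrite sumrB -big_distrl /= w_sum mul1r subrr.
Qed.

Local Lemma S_variance : \sum_y w y * (w y - s2) ^+ 2 = s3 - s2 ^+ 2.
Proof.
transitivity (\sum_y (w y ^+ 3 + (- (2 * s2) * w y ^+ 2 + s2 ^+ 2 * w y))).
  by apply: eq_bigr => y _; ring.
by rewrite !big_split /= -!big_distrr /= w_sum -/s2 -/s3; ring.
Qed.

Local Lemma sum_delta (f : T -> R) y : \sum_a f a * (a == y)%:R = f y.
Proof.
rewrite (bigD1 y) //= eqxx mulr1 big1 ?addr0 // => a /negbTE ->.
by rewrite mulr0.
Qed.

Local Lemma cnt_centred y : \sum_a w a * ((a == y)%:R - w y) = 0.
Proof.
under eq_bigr do rewrite mulrBr.
by rewrite sumrB -big_distrl /= w_sum mul1r sum_delta subrr.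
Qed.

Local Lemma cnt_variance y : \sum_a w a * ((a == y)%:R - w y) ^+ 2 = w y - w y ^+ 2.
Proof.
transitivity (\sum_a (w a * (a == y)%:R
    + (- (2 * w y) * (w a * (a == y)%:R) + w y ^+ 2 * w a))).
  by apply: eq_bigr => a _; case: eqP => _ /=; ring.
by rewrite !big_split /= -!big_distrr /= w_sum sum_delta; ring.
Qed.

Local Lemma mean_cnt s : \sum_y w y * cnt y s = S s.
Proof.
rewrite /S /cnt; under eq_bigr do rewrite big_distrr /=.
rewrite exchange_big; apply: eq_bigr => a _ /=.
under eq_bigr do rewrite mulrBr eq_sym -expr2.
by rewrite sumrB sum_delta.
Qed.

Local Lemma D_mean m : E m D = 0.
Proof.
elim: m => [|m IHm] /=; first by rewrite /D /= mul0r subrr.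
transitivity (\sum_y m%:R * (w y * (w y - s2))); last by rewrite -big_distrr /= S_centred mulr0.
apply: eq_bigr => y _.
rewrite (@eq_iidE _ _ _ _ _ (fun s => D s + (cnt y s + m%:R * (w y - s2)))); last first.
  by move=> s sm; rewrite D_cons sm addrA.
by rewrite iidED IHm iidED iidE_const // iidE_centred ?cnt_centred //; ring.
Qed.

Local Lemma DS_covariance m : E m (fun s => D s * S s) = m%:R * (m%:R - 1) * (s3 - s2 ^+ 2).
Proof.
elim: m => [|m IHm] /=; first by rewrite /S big_nil mulr0 !mul0r.
(* After expansion, every term linear in [D], [cnt y] or [S] alone has mean zero; these three
   survive. *)
transitivity (\sum_y (w y * E m (fun s => D s * S s)
   + E m (fun s => w y * (cnt y s * S s)) + m%:R * (w y * (w y - s2) ^+ 2))).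
  apply: eq_bigr => y _.
  rewrite (@eq_iidE _ _ _ _ _ (fun s => D s * S s + (cnt y s * S s
    + ((w y - s2) * D s + ((w y - s2) * cnt y s + (m%:R * (w y - s2) * S s
    + m%:R * (w y - s2) ^+ 2)))))); last first.
    by move=> s sm; rewrite D_cons S_cons sm; ring.
  rewrite !iidED !iidEZ iidE_const // D_mean (iidE_centred w_sum) ?cnt_centred //.
  rewrite (iidE_centred w_sum) ?S_centred //; ring.
rewrite !big_split /= -big_distrl /= w_sum -iidE_sum -big_distrr /= S_variance.
have -> : E m (fun s => \sum_y w y * (cnt y s * S s)) = E m (fun s => S s ^+ 2).
  apply: eq_iidE => s _; under eq_bigr do rewrite mulrA.
  by rewrite -big_distrl /= mean_cnt.
rewrite (iidE_centred_sqr w_sum) ?S_centred // S_variance IHm -natr1; ring.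
Qed.

(** Disjoint pairs of samples are uncorrelated. The first term collects the variances of single
    pairs; the second, the [m (m - 1) (m - 2)] ordered choices of two pairs sharing one sample, each
    of covariance [s3 - s2 ^+ 2]. *)
Lemma collisions_variance m :
  E m (fun s => ((seq_collisions s)%:R - 'C(m, 2)%:R * s2) ^+ 2) =
  'C(m, 2)%:R * (s2 - s2 ^+ 2) + m%:R * (m%:R - 1) * (m%:R - 2) * (s3 - s2 ^+ 2).
Proof.
rewrite (@eq_iidE _ _ _ _ _ (fun s => D s ^+ 2)); last by move=> s sm; rewrite /D sm.
elim: m => [|m IHm] /=; first by rewrite /D /= !mul0r subrr expr0n addr0.
(* Again the terms linear in [D] or [cnt y] drop out; averaging the cross term over [y] turns it
   into the covariance of [D] and [S]. *)
transitivity (\sum_y (w y * E m (fun s => D s ^+ 2)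
   + 2 * E m (fun s => w y * (D s * cnt y s))
   + m%:R * (w y ^+ 2 - w y ^+ 3)
   + m%:R ^+ 2 * (w y * (w y - s2) ^+ 2))).
  apply: eq_bigr => y _.
  rewrite (@eq_iidE _ _ _ _ _ (fun s => D s ^+ 2 + (cnt y s ^+ 2
    + (2 * (D s * cnt y s) + ((2 * m%:R * (w y - s2)) * D s
    + (2 * m%:R * (w y - s2) * cnt y s + m%:R ^+ 2 * (w y - s2) ^+ 2)))))); last first.
    by move=> s sm; rewrite D_cons sm; ring.
  rewrite !iidED !iidEZ iidE_const // D_mean (iidE_centred w_sum) ?cnt_centred //.
  rewrite (iidE_centred_sqr w_sum) ?cnt_centred // cnt_variance; ring.
rewrite !big_split /= -big_distrl /= w_sum -!big_distrr /= -iidE_sum S_variance.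
have -> : E m (fun s => \sum_y w y * (D s * cnt y s)) = E m (fun s => D s * S s).
  apply: eq_iidE => s _; under eq_bigr do rewrite mulrCA.
  by rewrite -big_distrr /= mean_cnt.
by rewrite sumrB -/s2 -/s3 DS_covariance IHm binS bin1 natrD -natr1; ring.
Qed.

End CollisionVariance.

(** * Comparison of norms, and power sums around the uniform distribution *)

Lemma normr_le_sqrt_sum (R : rcfType) (I : finType) (v : I -> R) i :
  `|v i| <= Num.sqrt (\sum_j v j ^+ 2).
Proof.
rewrite -sqrtr_sqr ler_sqrt ?sumr_ge0 // => [|j _]; last exact: sqr_ge0.
by rewrite (bigD1 i) //= lerDl sumr_ge0 // => j _; exact: sqr_ge0.
Qed.

(** By contraposition: if the l2 norm is below [eps], so is every entry, and for finite [p = r] each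
    [|V_i|^r] is at most [V_i^2 eps^(r-2)]; these sum to less than [eps^r]. *)
Lemma lp_norm_le_l2 (R : realType) (p : \bar R) n (V : 'rV[R]_n) (eps : R) :
  (2%:E < p)%E -> 0 < eps -> eps <= lp_norm p V ->
  eps ^+ 2 <= \sum_i V 0 i ^+ 2.
Proof.
move=> hp eps0; apply: contraTT; rewrite -!ltNge => Veps.
have Vi i : `|V 0 i| < eps.
  apply: le_lt_trans (normr_le_sqrt_sum _ i) _.
  by rewrite -(ger0_norm (ltW eps0)) -sqrtr_sqr ltr_sqrt // exprn_gt0.
case: p hp => [r| |] //= hp; last exact: bigmax_lt.
have r2 : 0 < r - 2 by rewrite subr_gt0 -lte_fin.
have r0 : 0 < r by lra.
have sqrM (a : R) : 0 <= a -> a `^ r = a ^+ 2 * a `^ (r - 2).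
  move=> a0; rewrite -powR_mulrn // -powRD; first by congr (_ `^ _); ring.
  by apply/implyP => /eqP; lra.
have sum_lt : \sum_i `|V 0 i| `^ r < eps `^ r.
  rewrite (sqrM eps) ?ltW //.
  apply: (@le_lt_trans _ _ ((\sum_i V 0 i ^+ 2) * eps `^ (r - 2))); last first.
    by rewrite ltr_pM2r ?powR_gt0.
  rewrite big_distrl; apply: ler_sum => i _ /=.
  rewrite sqrM // real_normK ?num_real // ler_wpM2l ?sqr_ge0 //.
  by rewrite ge0_ler_powR ?nnegrE ?normr_ge0 ?ltW.
rewrite -[ltRHS]powRr1 ?ltW // -[X in _ < _ `^ X](mulfV (lt0r_neq0 r0)) powRrM.
rewrite gt0_ltr_powR ?invr_gt0 ?nnegrE ?powR_ge0 //.
by apply: sumr_ge0 => i _; exact: powR_ge0.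
Qed.

Section UniformDeviation.
Variables (R : rcfType) (n : nat) (w : 'I_n -> R).
Hypothesis n_gt0 : (0 < n)%N.
Hypothesis w_sum : \sum_i w i = 1.

Let X := \sum_i (w i - n%:R^-1) ^+ 2.
Let s2 := \sum_i w i ^+ 2.
Let s3 := \sum_i w i ^+ 3.

Local Lemma n_neq0 : n%:R != 0 :> R.
Proof. by rewrite pnatr_eq0 -lt0n. Qed.

Lemma sum_sqr_deviation : s2 = n%:R^-1 + X.
Proof.
rewrite /X; have := mulfV n_neq0; set u := n%:R^-1 => nu.
have -> : \sum_i (w i - u) ^+ 2 = \sum_i (w i ^+ 2 + (- (2 * u) * w i + u ^+ 2)).
  by apply: eq_bigr => i _; ring.
rewrite !big_split /= -!big_distrr /= w_sum sumr_const card_ord -/s2 -[_ *+ n]mulr_natl.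
by rewrite nu; ring.
Qed.

(** Expansion around [1/n] gives exactly [X/n - X^2] plus the sum of cubed deviations, and each
    deviation is at most [sqrt X]. *)
Lemma sum_cube_deviation_le : s3 - s2 ^+ 2 <= X / n%:R + Num.sqrt X ^+ 3 - X ^+ 2.
Proof.
have X0 : 0 <= X by apply: sumr_ge0 => i _; exact: sqr_ge0.
have cube_le : \sum_i (w i - n%:R^-1) ^+ 3 <= Num.sqrt X ^+ 3.
  rewrite exprS sqr_sqrtr // big_distrr; apply: ler_sum => i _ /=.
  rewrite exprS ler_wpM2r ?sqr_ge0 // (le_trans (ler_norm _)) //.
  exact: normr_le_sqrt_sum (fun j => w j - n%:R^-1) i.
have := sum_sqr_deviation; move: cube_le (mulfV n_neq0).
set u := n%:R^-1 => cube_le nu s2E.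
have cube : \sum_i (w i - u) ^+ 3 = s3 - 3 * u * s2 + 2 * u ^+ 2.
  have -> : \sum_i (w i - u) ^+ 3 =
      \sum_i (w i ^+ 3 + (- (3 * u) * w i ^+ 2 + (3 * u ^+ 2 * w i - u ^+ 3))).
    by apply: eq_bigr => i _; ring.
  rewrite !big_split /= -!big_distrr /= w_sum sumr_const card_ord -/s2 -/s3.
  rewrite -[_ *+ n]mulr_natl (_ : n%:R * - u ^+ 3 = - (n%:R * u * u ^+ 2)); last by ring.
  by rewrite nu; ring.
rewrite cube s2E in cube_le; rewrite s2E; lra.
Qed.
End UniformDeviation.

(** * The sample size, and the comparison of variance with gap *)

Lemma sample_boundE (R : realType) (n : nat) (eps delta : R) : (0 < n)%N -> 0 < eps ->
  0 < delta ->
  sample_bound n eps delta = 9 / delta * Num.max (1 / (Num.sqrt n%:R * eps ^+ 2)) (1 / eps).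
Proof.
move=> n0 e0 d0; rewrite /sample_bound; congr (_ * _).
have q0 : 0 < Num.sqrt n%:R :> R by rewrite sqrtr_gt0 ltr0n.
have -> : (n%:R <= 1 / eps ^+ 2) = (Num.sqrt n%:R * eps <= 1).
  rewrite ler_pdivlMr ?exprn_gt0 // -[n%:R in LHS]sqr_sqrtr ?ler0n // -exprMn.
  by rewrite expr_le1 // mulr_ge0 // ltW.
(* The branches differ by the factor [Num.sqrt n%:R * eps], the very quantity that the case test
   compares with 1. *)
have -> : 1 / (Num.sqrt n%:R * eps ^+ 2) = (1 / eps) / (Num.sqrt n%:R * eps).
  by field; rewrite !lt0r_neq0.
have qe : 0 < Num.sqrt n%:R * eps by rewrite mulr_gt0.
have ie : 0 < 1 / eps by rewrite divr_gt0.
case: leP => h; [rewrite max_l // | rewrite max_r //].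
  by rewrite ler_pdivlMr // ler_piMr // ltW.
by rewrite ler_pdivrMr // ler_peMr // ltW.
Qed.

Lemma sample_bound_le_num_samples (R : realType) (n : nat) (eps delta : R) :
  0 <= sample_bound n eps delta ->
  sample_bound n eps delta <= (num_samples n eps delta)%:R.
Proof.
move=> b0; apply: le_trans (Num.Theory.ceil_ge _) _.
by rewrite /num_samples natr_absz ger0_norm // -(ler_int R) (le_trans b0) // Num.Theory.ceil_ge.
Qed.

(* Used with [M] samples, [N] pairs, [x = ||A - U_n||_2], [z = 1 / sqrt n],
   [sigma = \sum A_i ^ 3 - (\sum A_i ^ 2) ^ 2] and [L] the excess of the
   threshold over [N / n]. The left-hand side dominates the variance of the
   collision count, and [N * x ^+ 2 - L] is its mean minus the threshold.
   Everything is compared with [N * K]: the constants are 1/162 + 1/162 + 5/18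
   on the left, and (7/8)^2 * 9/19 on the right. *)
Lemma variance_le_gap (R : realFieldType) (delta M N x z L sigma : R) :
  0 < delta -> delta < 1 / 2 -> 19 <= M -> N = M * (M - 1) / 2 ->
  0 < x -> 0 < z -> z <= 1 ->
  9 <= delta * M * x -> 9 * z <= delta * M * x ^+ 2 ->
  0 <= L -> delta * L ^+ 2 = N * z ^+ 2 ->
  sigma <= x ^+ 2 * z ^+ 2 + x ^+ 3 - x ^+ 4 ->
  L <= N * x ^+ 2 / 8 /\
  N * (z ^+ 2 + x ^+ 2) + M * (M - 1) * (M - 2) * sigma <= delta * (N * x ^+ 2 - L) ^+ 2.
Proof.
move=> delta_gt0 delta_lt M_ge NE x_gt0 z_gt0 z_le1 Mx_ge Mx2_ge L_ge0 LE sigma_le.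
have [M_ge0 x_ge0 z_ge0] : [/\ 0 <= M, 0 <= x & 0 <= z] by split; lra.
have N_gt0 : 0 < N by rewrite NE divr_gt0 // mulr_gt0 //; lra.
pose K := delta * M ^+ 2 * x ^+ 4.
have K_ge0 : 0 <= K.
  apply: mulr_ge0; last exact: exprn_even_ge0.
  by apply: mulr_ge0; [exact: ltW | exact: sqr_ge0].
have dK : delta * K <= 1 / 2 * K by rewrite ler_wpM2r // ltW.
(* Squaring the hypothesis gives [81 z^2 <= delta K], and [delta < 1/2] halves the bound; likewise
   for [x] below. *)
have z2_le : z ^+ 2 <= K / 162.
  have z9 : 0 <= 9 * z by lra.
  have : (9 * z) ^+ 2 <= (delta * M * x ^+ 2) ^+ 2.
    by rewrite lerXn2r ?nnegrE // (le_trans z9).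
  have -> : (delta * M * x ^+ 2) ^+ 2 = delta * K by rewrite /K; ring.
  lra.
have x2_le : x ^+ 2 <= K / 162.
  have : 9 ^+ 2 * x ^+ 2 <= (delta * M * x) ^+ 2 * x ^+ 2.
    have Mx0 : 0 <= delta * M * x by lra.
    by rewrite ler_wpM2r ?sqr_ge0 // lerXn2r ?nnegrE.
  have -> : (delta * M * x) ^+ 2 * x ^+ 2 = delta * K by rewrite /K; ring.
  lra.
(* [M >= 19] gives [M - 1 >= 18/19 M], hence [N >= 9/19 M^2]. *)
have K_le : 9 / 19 * K <= delta * N * x ^+ 4.
  have -> : delta * N * x ^+ 4 = N * (delta * x ^+ 4) by ring.
  have -> : 9 / 19 * K = 9 / 19 * M ^+ 2 * (delta * x ^+ 4) by rewrite /K; ring.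
  rewrite ler_wpM2r //; first by apply: mulr_ge0; [exact: ltW | exact: exprn_even_ge0].
  have M19 : 0 <= M - 19 by lra.
  have := mulr_ge0 M_ge0 M19; rewrite NE; lra.
have Nx_ge0 : 0 <= N * x ^+ 2 by apply: mulr_ge0; [exact: ltW | exact: sqr_ge0].
(* After squaring and scaling by [delta], this reduces to [1/162 <= 9/(19 * 64)]. *)
have gap : L <= N * x ^+ 2 / 8.
  rewrite -(@ler_pXn2r _ 2) ?nnegrE //; last lra.
  rewrite -(ler_pM2l delta_gt0) LE.
  have -> : delta * (N * x ^+ 2 / 8) ^+ 2 = N * (delta * N * x ^+ 4 / 64) by field.
  rewrite ler_pM2l //; lra.
split=> //.
(* If [z <= x], the left side is at most [x]. Otherwise it is at most [5/4 z], by [z <= 1] and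
   [(x - z/2)^2 >= 0]; dividing by 9 gives 5/36. *)
have moment : z ^+ 2 + x - x ^+ 2 <= 5 / 36 * (delta * M * x ^+ 2).
  case: (lerP z x) => zx.
    have z2 : z ^+ 2 <= x ^+ 2 by rewrite lerXn2r ?nnegrE.
    have : 9 * x <= delta * M * x * x by rewrite ler_pM2r.
    lra.
  apply: (@le_trans _ _ (5 / 4 * z)); last lra.
  rewrite -(ler_pM2l z_gt0).
  have zx2 : 0 <= z ^+ 2 - x ^+ 2 by rewrite subr_ge0 lerXn2r ?nnegrE ?ltW.
  have : z * (z ^+ 2 - x ^+ 2) <= 1 * (z ^+ 2 - x ^+ 2) by rewrite ler_wpM2r.
  have := sqr_ge0 (x - z / 2); lra.
have sigma_le' : sigma <= 5 / 36 * (delta * M * x ^+ 4).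
  have : x ^+ 2 * (z ^+ 2 + x - x ^+ 2) <= x ^+ 2 * (5 / 36 * (delta * M * x ^+ 2)).
    by rewrite ler_wpM2l ?sqr_ge0.
  lra.
have B0 : 0 <= delta * M * x ^+ 4.
  by apply: mulr_ge0; [apply: mulr_ge0 => //; exact: ltW | exact: exprn_even_ge0].
have sB : 2 * (M - 2) * sigma <= 5 / 18 * K.
  have M2 : 0 <= M - 2 by lra.
  have : (M - 2) * sigma <= (M - 2) * (5 / 36 * (delta * M * x ^+ 4)) by rewrite ler_wpM2l.
  rewrite /K; lra.
have -> : N * (z ^+ 2 + x ^+ 2) + M * (M - 1) * (M - 2) * sigma =
    N * (z ^+ 2 + x ^+ 2 + 2 * (M - 2) * sigma) by rewrite NE; field.
apply: (@le_trans _ _ (delta * (7 / 8 * (N * x ^+ 2)) ^+ 2)).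
  have -> : delta * (7 / 8 * (N * x ^+ 2)) ^+ 2 = N * (49 / 64 * (delta * N * x ^+ 4)) by field.
  rewrite ler_pM2l //; lra.
by rewrite ler_pM2l // lerXn2r ?nnegrE //; lra.
Qed.

(** * Correctness of the tester *)

Lemma Pr_iidE (R : realType) n (A : 'rV[R]_n) m (P : pred (seq 'I_n)) :
  Pr_iid A (fun x : m.-tuple 'I_n => P x) = iidE (fun i => A 0 i) m (fun s => (P s)%:R).
Proof.
rewrite iidE_tuple /Pr_iid big_mkcond; apply: eq_bigr => x _ /=.
by case: (P x); rewrite ?mul1r ?mul0r.
Qed.

Lemma natr_bin2 (R : realFieldType) m : 'C(m, 2)%:R = m%:R * (m%:R - 1) / 2 :> R.
Proof.
elim: m => [|m IHm]; first by rewrite !mul0r.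
by rewrite binS bin1 natrD IHm -natr1; field.
Qed.

Lemma sum_sqr_sub_unif (R : realType) n (A : 'rV[R]_n) :
  \sum_i (A - unif R n) 0 i ^+ 2 = \sum_i (A 0 i - n%:R^-1) ^+ 2.
Proof. by apply: eq_bigr => i _; rewrite !mxE. Qed.

Theorem theorem4 (R : realType) (p : \bar R) (n : nat) (eps delta : R)
    (hp : (2%:E < p)%E) (hn : (2 <= n)%N)
    (heps0 : 0 < eps) (heps1 : eps < 1)
    (hdelta0 : 0 < delta) (hdelta2 : delta < 1 / 2)
    (A : 'rV[R]_n) (hA : is_distribution A) :
  let m := num_samples n eps delta in
  (A = unif R n ->
     1 - delta <=
       Pr_iid A (fun x : m.-tuple 'I_n => collision_tester delta x)) /\
  (eps <= lp_norm p (A - unif R n) ->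
     1 - delta <=
       Pr_iid A (fun x : m.-tuple 'I_n => ~~ collision_tester delta x)).
Proof.
move=> m; case: hA => A0 A1; have n0 : (0 < n)%N by apply: ltn_trans hn.
have q0 : 0 < Num.sqrt n%:R :> R by rewrite sqrtr_gt0 ltr0n.
have q2 : Num.sqrt n%:R ^+ 2 = n%:R :> R by rewrite sqr_sqrtr.
have id0 : 0 < 9 / delta by rewrite divr_gt0.
have bM : sample_bound n eps delta <= m%:R.
  apply: sample_bound_le_num_samples; rewrite sample_boundE //.
  by rewrite mulr_ge0 ?ltW // lt_max (divr_gt0 ltr01 heps0) orbT.
rewrite sample_boundE // in bM.
have Meps : 9 <= delta * m%:R * eps.
  have : 9 / delta * (1 / eps) <= m%:R.
    by apply: le_trans bM; rewrite ler_wpM2l ?(ltW id0) // le_max lexx orbT.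
  rewrite mul1r -mulrA -invfM ler_pdivrMr ?mulr_gt0 // mulrA; lra.
have Meps2 : 9 <= delta * m%:R * (Num.sqrt n%:R * eps ^+ 2).
  have : 9 / delta * (1 / (Num.sqrt n%:R * eps ^+ 2)) <= m%:R.
    by apply: le_trans bM; rewrite ler_wpM2l ?(ltW id0) // le_max lexx.
  rewrite mul1r -mulrA -invfM ler_pdivrMr ?mulr_gt0 ?exprn_gt0 // mulrA; lra.
(* [9 <= delta m eps] and [delta eps < 1/2] force [m > 18]; integrality then gives 19. *)
have M18 : 18 < m%:R :> R.
  have d : delta * eps < 1 / 2 by rewrite (le_lt_trans _ hdelta2) // ler_piMr ?ltW.
  have : 0 < m%:R :> R.
    rewrite lt0r ler0n andbT; apply/eqP => M0; move: Meps; rewrite M0 mulr0 mul0r; lra.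
  rewrite mulrAC in Meps; move=> M0; have /= := ltr_pM2r M0 (delta * eps) (1 / 2).
  rewrite d => h; lra.
have M19 : 19 <= m%:R :> R by rewrite ler_nat; rewrite ltr_nat in M18.
pose N : R := 'C(m, 2)%:R.
pose L : R := Num.sqrt (1 / delta * N * (1 / n%:R)).
have NE : N = m%:R * (m%:R - 1) / 2 by exact: natr_bin2.
have N0 : 0 < N by rewrite NE divr_gt0 // mulr_gt0 //; lra.
have nV0 : 0 < 1 / n%:R :> R by rewrite divr_gt0 ?ltr0n.
have arg0 : 0 < 1 / delta * N * (1 / n%:R) by apply: mulr_gt0 => //; apply: mulr_gt0 => //; apply: divr_gt0.
have L0 : 0 < L by rewrite sqrtr_gt0.
have L2 : delta * L ^+ 2 = N * n%:R^-1.
  by rewrite (sqr_sqrtr (ltW arg0)); field; rewrite !lt0r_neq0 ?ltr0n.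
pose P (s : seq 'I_n) := (seq_collisions s)%:R <= N * (1 / n%:R) + L.
have PE (x : m.-tuple 'I_n) : collision_tester delta x = P x.
  by rewrite /collision_tester collisionsE.
have var := collisions_variance A1 m.
have s2E := sum_sqr_deviation n0 A1.
have s3_le := sum_cube_deviation_le n0 A1.
set s2 := \sum_i A 0 i ^+ 2 in var s2E s3_le.
set s3 := \sum_i A 0 i ^+ 3 in var s3_le.
set X := \sum_i (A 0 i - n%:R^-1) ^+ 2 in s2E s3_le.
pose D (s : seq 'I_n) : R := (seq_collisions s)%:R - N * s2.
split=> [Aunif | far].
  have X0 : X = 0.
    by rewrite /X big1 // => i _; rewrite Aunif mxE subrr expr0n.
  rewrite X0 addr0 in s2E; rewrite X0 sqrtr0 mul0r !expr0n /= addr0 subr0 in s3_le.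
  rewrite (_ : Pr_iid _ _ = Pr_iid A (fun x : m.-tuple 'I_n => P x)); last first.
    by apply: eq_bigl => x; exact: PE.
  rewrite Pr_iidE; apply: (chebyshev_iidE (D := D) A0 A1 L0).
    (* The threshold is set so that [delta L^2 = N/n]; here [s2 = 1/n], and the shared-sample term
       is nonpositive. *)
    rewrite var L2 -/N -s2E.
    have h : m%:R * (m%:R - 1) * (m%:R - 2) * (s3 - s2 ^+ 2) <= 0.
      by rewrite mulr_ge0_le0 // !mulr_ge0 //; lra.
    have := mulr_ge0 (ltW N0) (sqr_ge0 s2); lra.
  move=> s _; rewrite /P -ltNge mul1r => Ps.
  have LD : L <= D s by rewrite /D s2E; lra.
  by rewrite lerXn2r ?nnegrE ?(le_trans (ltW L0)) // ltW.
have XE : eps ^+ 2 <= X.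
  by rewrite /X -sum_sqr_sub_unif; apply: lp_norm_le_l2 far.
have X0 : 0 < X by rewrite (lt_le_trans _ XE) ?exprn_gt0.
pose x : R := Num.sqrt X; have x0 : 0 < x by rewrite sqrtr_gt0.
have x2 : x ^+ 2 = X by rewrite sqr_sqrtr ?ltW.
have epsx : eps <= x by rewrite -(ger0_norm (ltW heps0)) -sqrtr_sqr ler_sqrt // ltW.
pose z : R := (Num.sqrt n%:R)^-1; have z0 : 0 < z by rewrite invr_gt0.
have z2 : z ^+ 2 = n%:R^-1 by rewrite exprVn q2.
have z1 : z <= 1.
  by rewrite /z invf_le1 // -[leLHS]sqrtr1 ler_sqrt ?ler1n ?ler0n ?ltr0n.
have dM : 0 < delta * m%:R by rewrite mulr_gt0 //; lra.
(* Both lower bounds on [m] weaken as the distance grows, so they pass from [eps] to [x >= eps]. *)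
have Mx : 9 <= delta * m%:R * x by rewrite (le_trans Meps) // ler_pM2l.
have Mx2 : 9 * z <= delta * m%:R * x ^+ 2.
  rewrite ler_pdivrMr // (le_trans Meps2) // -[leRHS]mulrA (ler_pM2l dM).
  by rewrite [leRHS]mulrC ler_pM2l // x2.
have L2z : delta * L ^+ 2 = N * z ^+ 2 by rewrite L2 z2.
have sl : s3 - s2 ^+ 2 <= x ^+ 2 * z ^+ 2 + x ^+ 3 - x ^+ 4.
  by rewrite z2 (exprM x 2 2) x2.
have [gap var_le] := variance_le_gap hdelta0 hdelta2 M19 NE x0 z0 z1 Mx Mx2 (ltW L0) L2z sl.
have Nx : 0 < N * x ^+ 2 by rewrite mulr_gt0 ?exprn_gt0.
have t0 : 0 < N * x ^+ 2 - L by lra.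
rewrite (_ : Pr_iid _ _ = Pr_iid A (fun x : m.-tuple 'I_n => ~~ P x)); last first.
  by apply: eq_bigl => y; rewrite /= PE.
rewrite (Pr_iidE _ _ (fun s => ~~ P s)); apply: (chebyshev_iidE (D := D) A0 A1 t0).
  apply: le_trans var_le.
  rewrite var -/N z2 x2 -s2E lerD2r ler_pM2l //.
  by have := sqr_ge0 s2; lra.
move=> s _; rewrite negbK /P mul1r => Ps.
(* A wrong acceptance puts the count below its mean by at least the gap, so the deviation is
   negative and [- D s] is compared. *)
have LD : N * x ^+ 2 - L <= - D s by rewrite /D s2E x2; lra.
by rewrite -[D s ^+ 2]sqrrN lerXn2r ?nnegrE ?(le_trans (ltW t0)) // ltW.
Qed.
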